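(* Let $\mathcal{L}\in\{\mathrm{SUM},\mathrm{OR},\mathrm{XOR}\}$ and let $A$ be a symmetric boolean $r\times r$ matrix. Let $F$ be a compact $\mathcal{L}$-covering of $A$ and let $G$ be a compact one-sided $\mathcal{L}$-covering of $A$, with $\sigma(G)\ge\sigma(F)$. If \[ \frac{\sigma(G)}{\sigma(F)} < \mu_G^{2\lambda_F}, \] then, writing $N=r^n$, there is a constant $C>0$ (depending on $A,F,G$ but not on $n$) such that for all $n\ge 1$, \[ \mathcal{L}_2(A^{\otimes n}) \le C\, N^{\log_r \sigma(F)}. \]
   Context: A rectangle of size $a\times b$ in a boolean matrix of given dimensions is a rank-1 boolean matrix whose 1-entries form an all-1s submatrix with $a$ rows and $b$ columns (all other entries $0$). Its complexity is $w(R)=a+b$, its spectral weight is $\sigma(R)=\sqrt{ab}$, and its narrowness is $\rho(R)=\max(a,b)/\min(a,b)$. A finite family $F=\{R_1,\dots,R_k\}$ of rectangles is an $\mathcal{L}$-covering of a boolean matrix $A$ if $A=R_1+\dots+R_k$, where ''$+$'' is integer addition for $\mathcal{L}=\mathrm{SUM}$, disjunction for $\mathcal{L}=\mathrm{OR}$, and addition mod 2 for $\mathcal{L}=\mathrm{XOR}$. Its complexity is $w(F)=\sum_i w(R_i)$ and its spectral weight $\sigma(F)=\sum_i\sigma(R_i)$. $\mathcal{L}_2(A)$ denotes the minimum complexity of an $\mathcal{L}$-covering of $A$. $A^{\otimes n}$ is the $n$-th Kronecker power of $A$ (the Kronecker product $A\otimes B$ of boolean matrices replaces each 1-entry of $A$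 by a copy of $B$ and each 0-entry by an all-0s block of the same size). For a covering $F$ consisting of $a_i\times b_i$ rectangles $R_i$ ($i=1,\dots,s$), its characteristic function is $\chi_F(x)=\sum_{i=1}^s\sigma(R_i)(a_i/b_i)^x-\sigma(F)$ for real $x$ (so $\chi_F(0)=0$). $F$ is called compact if $\chi_F$ takes negative values at some negative arguments. For compact $F$, $\lambda_F$ denotes the smallest real root $x_0$ of $\chi_F$ such that $\chi_F<0$ on some interval $(x_0,x_0+\varepsilon)$, $\varepsilon>0$. A covering $G$ is one-sided if its rectangles $R'_i$ of size $a'_i\times b'_i$ all satisfy $a'_i\ge b'_i$ (the longer sides of all non-square rectangles are parallel). For such $G$, $\mu_G=\frac{1}{\sigma(G)}\sum_{R\in G}\frac{\sigma(R)}{\sqrt{\rho(R)}}=\frac{1}{\sigma(G)}\sum_i b'_i$. *)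

(* Defs.v *)
From mathcomp Require Import all_boot all_order all_algebra.
From mathcomp Require Import boolp reals exp.
From mathcomp Require Export mxtens.

Set Implicit Arguments.
Unset Strict Implicit.
Unset Printing Implicit Defensive.

Import Order.TTheory GRing.Theory Num.Theory.
Local Open Scope ring_scope.

(* The rank-1 boolean matrix with support [rrows x rcols]; rank 1 means that
   both sides are nonempty. *)
Record rect (m n : nat) := Rect {
  rrows : {set 'I_m};
  rcols : {set 'I_n};
  rrows_neq0 : rrows != set0;
  rcols_neq0 : rcols != set0 }.

Definition rect_mx m n (R : rect m n) : 'M[bool]_(m, n) :=
  \matrix_(i, j) ((i \in rrows R) && (j \in rcols R)).

Definition rheight m n (R : rect m n) : nat := #|rrows R|.
Definition rwidth m n (R : rect m n) : nat := #|rcols R|.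

Inductive mode := SUM | OR | XOR.

(* Coverings are sequences, so repeated rectangles count with multiplicity. *)
Definition covering (L : mode) m n (A : 'M[bool]_(m, n))
    (F : seq (rect m n)) : Prop :=
  forall i j,
    match L with
    | SUM => (\sum_(R <- F) rect_mx R i j)%N = A i j :> nat
    | OR => \big[orb/false]_(R <- F) rect_mx R i j = A i j
    | XOR => \big[addb/false]_(R <- F) rect_mx R i j = A i j
    end.

Definition rcomplexity m n (R : rect m n) : nat := (rheight R + rwidth R)%N.

Definition complexity m n (F : seq (rect m n)) : nat :=
  (\sum_(R <- F) rcomplexity R)%N.

Lemma set1_neq0 (T : finType) (x : T) : [set x] != set0.
Proof. by apply/set0Pn; exists x; rewrite inE. Qed.

Definition rect1 m n (p : 'I_m * 'I_n) : rect m n :=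
  Rect (set1_neq0 p.1) (set1_neq0 p.2).

Lemma big_rect1 (T : Type) (idx : T) (op : Monoid.com_law idx) (f : bool -> T)
    m n (A : 'M[bool]_(m, n)) i j : f false = idx ->
  \big[op/idx]_(R <- [seq rect1 p | p <- enum [pred p | A p.1 p.2]])
     f (rect_mx R i j) = f (A i j).
Proof.
move=> f0; rewrite big_map big_enum /=.
have E (p : 'I_m * 'I_n) : rect_mx (rect1 p) i j = (p == (i, j)).
  by rewrite mxE !inE /= [i == _]eq_sym [j == _]eq_sym -xpair_eqE -surjective_pairing.
under eq_bigr => p _ do rewrite E.
have [Aij | /negPf Aij] := boolP (A i j).
  rewrite (bigD1 (i, j)) //= eqxx big1 ?Monoid.mulm1 // => p /andP[_].
  by move=> /negPf ->.
rewrite big1 // => p; case: eqP => [-> /= | _ _]; last exact: f0.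
by rewrite inE /= Aij.
Qed.

Lemma covering_exists L m n (A : 'M[bool]_(m, n)) :
  exists k, `[< exists F, covering L A F /\ complexity F = k >].
Proof.
set F := [seq rect1 p | p <- enum [pred p | A p.1 p.2]].
exists (complexity F); apply/asboolP; exists F; split=> // i j.
case: L; first exact: (@big_rect1 _ _ addn nat_of_bool).
  exact: (@big_rect1 _ _ orb id).
exact: (@big_rect1 _ _ addb id).
Qed.

Definition L2 (L : mode) m n (A : 'M[bool]_(m, n)) : nat :=
  ex_minn (covering_exists L A).

Section Real.
Context {R : realType}.

Definition rsigma m n (Q : rect m n) : R :=
  Num.sqrt ((rheight Q)%:R * (rwidth Q)%:R).

Definition sigma m n (F : seq (rect m n)) : R := \sum_(Q <- F) rsigma Q.

Definition narrowness m n (Q : rect m n) : R :=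
  (maxn (rheight Q) (rwidth Q))%:R / (minn (rheight Q) (rwidth Q))%:R.

Definition chi m n (F : seq (rect m n)) (x : R) : R :=
  \sum_(Q <- F) rsigma Q * ((rheight Q)%:R / (rwidth Q)%:R) `^ x - sigma F.

Definition compact_covering m n (F : seq (rect m n)) : Prop :=
  exists x : R, x < 0 /\ chi F x < 0.

Definition descending_root m n (F : seq (rect m n)) (x0 : R) : Prop :=
  chi F x0 = 0 /\
  exists eps : R, 0 < eps /\ forall x, x0 < x < x0 + eps -> chi F x < 0.

(* A relation, because there is no such root when [chi F] is increasing
   (height >= width for all rectangles of [F]). *)
Definition is_lambda m n (F : seq (rect m n)) (l : R) : Prop :=
  descending_root F l /\ forall x, descending_root F x -> l <= x.

Definition mu m n (G : seq (rect m n)) : R :=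
  (sigma G)^-1 * \sum_(Q <- G) rsigma Q / Num.sqrt (narrowness Q).

Definition logb (b x : R) : R := ln x / ln b.

End Real.

Definition one_sided m n (G : seq (rect m n)) : bool :=
  all (fun Q => (rwidth Q <= rheight Q)%N) G.

(* In the ring structure of [bool] the product is conjunction, so [A ^t n]
   is the [n]-th Kronecker power of a boolean matrix [A] for 0 < n. *)
Definition kron_pow r (A : 'M[bool]_r) (n : nat) : 'M[bool]_(r ^ n) := A ^t n.

(* Main.v *)
Require Import Defs.
From mathcomp Require Import all_boot all_order all_algebra.
From mathcomp Require Import reals exp.
From mathcomp Require Import boolp ring lra.
(* A covering of [A^n] is built one Kronecker factor at a time, the covering
   used for the next factor ([F], [G] or a transpose) depending on the shape of
   the rectangle [a x b] obtained so far.  Choosing a rectangle of [F] with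
   probability proportional to its spectral weight makes [ln (a / b)] a random
   walk, and orienting [F] towards balance gives
   [E max(a/b, b/a)^(-l) <= phi * max(a/b, b/a)^(-l) + O(1)] with [phi < 1] for
   [l] slightly above [lambda].  The complexity [a + b] is the spectral weight
   times [max(a/b, b/a)^(1/2)], so rectangles that become too narrow are costly;
   once [max(a/b, b/a)^(1/2)] exceeds [mu^(-m)], with [m] factors left, only [G]
   is used.  This multiplies the narrowness term by [mu^m] and increases the
   spectral weight by [(sigma G / sigma F)^m], which is less than
   [mu^(2 l m)], hence is absorbed by the moment of order [-l]. *)
Import Order.TTheory GRing.Theory Num.Theory.
Local Open Scope ring_scope.

(** * Kronecker products and transposes of rectangles and coverings *)

Lemma tens_set_neq0 m p (X : {set 'I_m}) (Y : {set 'I_p}) :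
  X != set0 -> Y != set0 -> @mxtens_index m p @: setX X Y != set0.
Proof.
case/set0Pn=> i Xi /set0Pn[j Yj]; apply/set0Pn; exists (mxtens_index (i, j)).
by apply: imset_f; rewrite in_setX Xi Yj.
Qed.

Definition tens_rect {m n p q} (Q : rect m n) (P : rect p q) :
    rect (m * p) (n * q) :=
  Rect (tens_set_neq0 m p _ _ (rrows_neq0 Q) (rrows_neq0 P))
       (tens_set_neq0 n q _ _ (rcols_neq0 Q) (rcols_neq0 P)).

Lemma mxtens_index_inj m n : injective (@mxtens_index m n).
Proof. exact: can_inj (@mxtens_indexK m n). Qed.

Lemma rheight_tens m n p q (Q : rect m n) (P : rect p q) :
  rheight (tens_rect Q P) = (rheight Q * rheight P)%N.
Proof. by rewrite /rheight card_imset ?cardsX //; exact: mxtens_index_inj. Qed.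

Lemma rwidth_tens m n p q (Q : rect m n) (P : rect p q) :
  rwidth (tens_rect Q P) = (rwidth Q * rwidth P)%N.
Proof. by rewrite /rwidth card_imset ?cardsX //; exact: mxtens_index_inj. Qed.

Lemma tens_rectE m n p q (Q : rect m n) (P : rect p q) i j k l :
  rect_mx (tens_rect Q P) (mxtens_index (i, j)) (mxtens_index (k, l)) =
  rect_mx Q i k && rect_mx P j l.
Proof.
rewrite !mxE /= !mem_imset; try exact: mxtens_index_inj.
by rewrite !in_setX /= andbACA.
Qed.

(** Distributivity treats the three modes at once: [f] is the inclusion of [bool] into [nat] for
    [SUM] and the identity for [OR] and [XOR]. *)
Lemma big_tens_rect (T : Type) (idx : T) (mul : Monoid.mul_law idx)
    (op : Monoid.add_law idx mul) (f : bool -> T) m n p q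
    (F : seq (rect m n)) (H : rect m n -> seq (rect p q)) i j k l (b : T) :
    {morph f : x y / x && y >-> mul x y} ->
    (forall Q, \big[op/idx]_(P <- H Q) f (rect_mx P j l) = b) ->
  \big[op/idx]_(P <- [seq tens_rect Q P | Q <- F, P <- H Q])
     f (rect_mx P (mxtens_index (i, j)) (mxtens_index (k, l))) =
  mul (\big[op/idx]_(Q <- F) f (rect_mx Q i k)) b.
Proof.
move=> fM Hb; rewrite big_allpairs_dep /= big_distrl /=.
apply: eq_bigr => Q _; rewrite -(Hb Q) big_distrr /=.
by apply: eq_bigr => P _; rewrite tens_rectE fM.
Qed.

(** [H] may vary with [Q] because every [H Q] covers the same [B]; this freedom makes adaptive
    coverings possible. *)
Lemma covering_tens L m n p q (A : 'M[bool]_(m, n)) (B : 'M[bool]_(p, q))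
    (F : seq (rect m n)) (H : rect m n -> seq (rect p q)) :
  covering L A F -> (forall Q, covering L B (H Q)) ->
  covering L (A *t B) [seq tens_rect Q P | Q <- F, P <- H Q].
Proof.
move=> cF cH x y.
case: (mxtens_indexP x) => i j; case: (mxtens_indexP y) => k l.
rewrite tensmxE; case: L cF cH => cF cH.
- rewrite (@big_tens_rect _ 0%N muln addn nat_of_bool _ _ _ _ _ _ _ _ _ _ (B j l)).
  + by rewrite cF; case: (A i k); case: (B j l).
  + by case; case.
  + by move=> Q; rewrite cH.
- rewrite (@big_tens_rect _ false andb orb id _ _ _ _ _ _ _ _ _ _ (B j l)) //.
  + by rewrite cF.
  + by move=> Q; rewrite cH.
- rewrite (@big_tens_rect _ false andb addb id _ _ _ _ _ _ _ _ _ _ (B j l)) //.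
  + by rewrite cF.
  + by move=> Q; rewrite cH.
Qed.

Definition trrect {m n} (Q : rect m n) : rect n m :=
  Rect (rcols_neq0 Q) (rrows_neq0 Q).

Lemma covering_tr L m n (A : 'M[bool]_(m, n)) F :
  covering L A F -> covering L A^T (map trrect F).
Proof.
move=> cF i j; have E (Q : rect m n) : rect_mx (trrect Q) i j = rect_mx Q j i.
  by rewrite !mxE andbC.
case: L cF => cF; rewrite big_map mxE -cF.
all: by apply: eq_bigr => Q _; rewrite E.
Qed.

Lemma L2_le L m n (A : 'M[bool]_(m, n)) F :
  covering L A F -> (L2 L A <= complexity F)%N.
Proof.
move=> cF; rewrite /L2; case: ex_minnP => k _; apply.
by apply/asboolP; exists F.
Qed.

(** * Weighted costs of coverings of Kronecker powers *)

Definition wcost {R : realType} {m n} (a b : R) (F : seq (rect m n)) : R :=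
  \sum_(Q <- F) (a * (rheight Q)%:R + b * (rwidth Q)%:R).

Lemma wcost_tens (R : realType) m n p q (a b : R) (F : seq (rect m n))
    (H : rect m n -> seq (rect p q)) :
  wcost a b [seq tens_rect Q P | Q <- F, P <- H Q] =
  \sum_(Q <- F) wcost (a * (rheight Q)%:R) (b * (rwidth Q)%:R) (H Q).
Proof.
rewrite /wcost big_allpairs_dep /=; apply: eq_bigr => Q _; apply: eq_bigr => P _.
by rewrite rheight_tens rwidth_tens !natrM !mulrA.
Qed.

(* [wcost a b] of a covering of [A^t m.+1] is the complexity of the covering of
   its Kronecker product with the all-ones [a x b] matrix. *)
Definition affordable {R : realType} (L : mode) {r} (A : 'M[bool]_r) (W : R)
    (m : nat) (a b B : R) : Prop :=
  exists2 H, covering L (A ^t m.+1) H & wcost a b H <= W * B.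

Section Affordable.
Context {R : realType} {L : mode} {r : nat} {A : 'M[bool]_r}.
Implicit Types (F : seq (rect r r)) (a b B W : R).

(** Powers of a symmetric [A] are symmetric, so transposing a covering swaps the weights; this
    justifies assuming [b <= a] later. *)
Lemma affordable_tr W m a b B : A^T = A ->
  affordable L A W m a b B -> affordable L A W m b a B.
Proof.
move=> symA [H cH wH]; exists (map trrect H).
  have -> : A ^t m.+1 = (A ^t m.+1)^T.
    elim: m {H cH wH} => [|m IH]; first by rewrite symA.
    by rewrite trmx_tens symA -IH.
  exact: covering_tr.
by apply: le_trans wH; rewrite /wcost big_map; apply: ler_sum => Q _; rewrite addrC.
Qed.

Lemma le_affordable W m a b B1 B2 : 0 <= W -> B1 <= B2 ->
  affordable L A W m a b B1 -> affordable L A W m a b B2.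
Proof.
by move=> W0 B12 [H cH wH]; exists H => //; apply: le_trans wH _; rewrite ler_wpM2l.
Qed.

Lemma affordable0 F a b : covering L A F -> 0 <= a -> 0 <= b ->
  affordable L A (complexity F)%:R 0 a b (a + b).
Proof.
move=> cF a0 b0; exists F => //.
rewrite /wcost /complexity natr_sum mulr_suml; apply: ler_sum => Q _.
rewrite /rcomplexity natrD.
by have := ler0n R (rheight Q); have := ler0n R (rwidth Q); nra.
Qed.

Lemma affordableS F W m a b (B : rect r r -> R) : covering L A F ->
  (forall Q, affordable L A W m (a * (rheight Q)%:R) (b * (rwidth Q)%:R) (B Q)) ->
  affordable L A W m.+1 a b (\sum_(Q <- F) B Q).
Proof.
move=> cF cH.
have /choice[H HP] Q : exists H, covering L (A ^t m.+1) H /\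
    wcost (a * (rheight Q)%:R) (b * (rwidth Q)%:R) H <= W * B Q.
  by have [H] := cH Q; exists H.
exists [seq tens_rect Q P | Q <- F, P <- H Q].
  by apply: covering_tens => // Q; have [] := HP Q.
rewrite wcost_tens mulr_sumr; apply: ler_sum => Q _; by have [] := HP Q.
Qed.

(** Balancing form of the recursion: for a rectangle with height at least width, the longer side
    multiplies [b]. *)
Lemma affordableS_tr F W m a b (B : rect r r -> R) : A^T = A -> covering L A F ->
  (forall Q, affordable L A W m (a * (rwidth Q)%:R) (b * (rheight Q)%:R) (B Q)) ->
  affordable L A W m.+1 a b (\sum_(Q <- F) B Q).
Proof.
move=> symA cF cH; apply: affordable_tr => //; apply: affordableS => // Q.
exact: affordable_tr.
Qed.

End Affordable.

(** * Effect of one rectangle on the imbalance of the sides *)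

Section Rectangle.
Context {R : realType} {r : nat}.
Implicit Types (Q : rect r r) (a b p : R).

Lemma rheight_ge1 Q : 1 <= (rheight Q)%:R :> R.
Proof. by rewrite ler1n card_gt0 rrows_neq0. Qed.

Lemma rwidth_ge1 Q : 1 <= (rwidth Q)%:R :> R.
Proof. by rewrite ler1n card_gt0 rcols_neq0. Qed.

Lemma rheight_le Q : (rheight Q)%:R <= r%:R :> R.
Proof. by rewrite ler_nat -[leqRHS]card_ord max_card. Qed.

Lemma rwidth_le Q : (rwidth Q)%:R <= r%:R :> R.
Proof. by rewrite ler_nat -[leqRHS]card_ord max_card. Qed.

Lemma rsigma_ge1 Q : 1 <= rsigma Q :> R.
Proof.
rewrite -[leLHS]sqrtr1 ler_wsqrtr //.
by have := rheight_ge1 Q; have := rwidth_ge1 Q; nra.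
Qed.

Lemma sqrtr_rect a b Q : 0 <= a -> 0 <= b ->
  Num.sqrt (a * (rwidth Q)%:R * (b * (rheight Q)%:R)) =
  Num.sqrt (a * b) * rsigma Q.
Proof. by move=> a0 b0; rewrite -sqrtrM ?mulr_ge0 //; congr Num.sqrt; ring. Qed.

Lemma sqrtr_between a b : 0 <= b -> b <= a -> b <= Num.sqrt (a * b) <= a.
Proof.
move=> b0 ba; have a0 : 0 <= a := le_trans b0 ba.
rewrite -{1}(ger0_norm b0) -{3}(ger0_norm a0) -!sqrtr_sqr.
by rewrite !ler_wsqrtr // expr2 ?ler_wpM2r ?ler_wpM2l.
Qed.

(** A short side that overtakes the long one still costs at most [r] times the new spectral
    weight. *)
Lemma short_side_le a b Q : 0 <= b -> b <= a ->
  b * (rheight Q)%:R <= r%:R * (Num.sqrt (a * b) * rsigma Q).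
Proof.
move=> b0 ba; have /andP[bE _] := sqrtr_between _ _ b0 ba.
rewrite [leRHS]mulrC ler_pM ?ler0n ?rheight_le //.
by rewrite -[leLHS]mulr1 ler_pM // rsigma_ge1.
Qed.

(** For positive sides, this is the square root of the narrowness. *)
Definition imbalance a b : R := Num.max a b / Num.sqrt (a * b).

Lemma imbalanceC a b : imbalance a b = imbalance b a.
Proof. by rewrite /imbalance maxC [a * b]mulrC. Qed.

Lemma imbalance_ge1 a b : 0 < a -> 0 < b -> 1 <= imbalance a b.
Proof.
move=> a0 b0; wlog ba : a b a0 b0 / b <= a => [H|].
  by case/orP: (le_total a b) => ?; [rewrite imbalanceC|]; apply: H.
rewrite ler_pdivlMr ?sqrtr_gt0 ?mulr_gt0 // mul1r max_l //.
by have /andP[] := sqrtr_between _ _ (ltW b0) ba.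
Qed.

(** If the side coming from [a] stays longer, the imbalance changes by the square root; if the sides
    cross, [short_side_le] bounds it by [r]. *)
Lemma imbalance_rect a b Q : 0 < b -> b <= a ->
  imbalance (a * (rwidth Q)%:R) (b * (rheight Q)%:R) <=
  Num.max (imbalance a b * Num.sqrt ((rwidth Q)%:R / (rheight Q)%:R)) r%:R.
Proof.
move=> b0 ba; have a0 : 0 < a := lt_le_trans b0 ba.
have h1 := rheight_ge1 Q; have w1 := rwidth_ge1 Q; have s1 := rsigma_ge1 Q.
have E0 : 0 < Num.sqrt (a * b) by rewrite sqrtr_gt0 mulr_gt0.
have Es0 : 0 < Num.sqrt (a * b) * rsigma Q.
  by rewrite mulr_gt0 // (lt_le_trans ltr01).
rewrite /imbalance (sqrtr_rect _ _ _ (ltW a0) (ltW b0)) ler_pdivrMr //.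
rewrite ge_max maxr_pMl ?(ltW Es0) // !le_max.
rewrite (short_side_le _ _ _ (ltW b0) ba) orbT andbT; apply/orP; left.
rewrite (max_l ba).
have -> : a / Num.sqrt (a * b) * Num.sqrt ((rwidth Q)%:R / (rheight Q)%:R) *
    (Num.sqrt (a * b) * rsigma Q) =
    a * (Num.sqrt ((rwidth Q)%:R / (rheight Q)%:R) * rsigma Q).
  by field; exact: lt0r_neq0.
rewrite -sqrtrM ?divr_ge0 ?ler0n // mulrA divfK; last first.
  by rewrite lt0r_neq0 // (lt_le_trans ltr01).
by rewrite -expr2 sqrtr_sqr ger0_norm ?ler0n.
Qed.

(** Limits how far a single step can overshoot the switching threshold. *)
Lemma imbalance_rect_le a b Q : 0 < b -> b <= a ->
  imbalance (a * (rwidth Q)%:R) (b * (rheight Q)%:R) <= r%:R * imbalance a b.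
Proof.
move=> b0 ba; have t1 : 1 <= imbalance a b.
  by rewrite imbalance_ge1 // (lt_le_trans b0).
apply: le_trans (imbalance_rect _ _ _ b0 ba) _.
rewrite ge_max ler_peMr ?ler0n // andbT mulrC ler_wpM2r ?(le_trans ler01) //.
have r1 : 1 <= r%:R :> R := le_trans (rheight_ge1 Q) (rheight_le Q).
rewrite -[leRHS]ger0_norm ?ler0n // -sqrtr_sqr ler_wsqrtr //.
have := rheight_ge1 Q; have := rwidth_le Q => wr h1.
rewrite ler_pdivrMr ?(lt_le_trans ltr01) //.
by rewrite expr2 -mulrA (le_trans wr) // ler_peMr ?ler0n //; nra.
Qed.

(** The power of a maximum is at most the sum of the powers. Weighted by [rsigma] and summed over
    [F], the ratio factor becomes the sum in [chi F (- (p / 2))]. *)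
Lemma imbalance_rect_powR p a b Q : 0 <= p -> 0 < b -> b <= a ->
  imbalance (a * (rwidth Q)%:R) (b * (rheight Q)%:R) `^ p <=
  imbalance a b `^ p * ((rheight Q)%:R / (rwidth Q)%:R) `^ (- (p / 2))
  + r%:R `^ p.
Proof.
move=> p0 b0 ba; have a0 : 0 < a := lt_le_trans b0 ba.
have h0 : 0 < (rheight Q)%:R :> R := lt_le_trans ltr01 (rheight_ge1 Q).
have w0 : 0 < (rwidth Q)%:R :> R := lt_le_trans ltr01 (rwidth_ge1 Q).
have t0 : 0 <= imbalance a b by rewrite (le_trans ler01) // imbalance_ge1.
have -> : ((rheight Q)%:R / (rwidth Q)%:R) `^ (- (p / 2)) =
    Num.sqrt ((rwidth Q)%:R / (rheight Q)%:R) `^ p :> R.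
  rewrite -[(rwidth Q)%:R / _]invf_div -powR12_sqrt ?invr_ge0 ?divr_ge0 ?ler0n //.
  rewrite -[_^-1 in RHS]powR_inv1 ?divr_ge0 ?ler0n // -!powRrM.
  by congr (_ `^ _); field.
rewrite -powRM ?sqrtr_ge0 //.
apply: (@le_trans _ _ (Num.max (imbalance a b *
    Num.sqrt ((rwidth Q)%:R / (rheight Q)%:R)) r%:R `^ p)).
  rewrite ge0_ler_powR ?nnegrE ?imbalance_rect //.
    by rewrite (le_trans ler01) // imbalance_ge1 // mulr_gt0.
  by rewrite le_max ler0n orbT.
set x := _ * Num.sqrt _.
by case: (leP x r%:R) => _; rewrite ?lerDl ?lerDr powR_ge0.
Qed.

End Rectangle.

(** * Cost bounds for the narrow and the balanced phase *)

Section Phases.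
Context {R : realType} {L : mode} {r : nat} {A : 'M[bool]_r} {W : R}.
Hypotheses (symA : A^T = A) (W0 : 0 <= W).
Hypothesis affordable_base : forall a b : R, 0 <= a -> 0 <= b ->
  affordable L A W 0 a b (a + b).
Implicit Types (F G : seq (rect r r)) (a b : R).

(* Orienting each rectangle of [G] so that its short side multiplies the long
   side of the current rectangle, the long sides are summed with weight
   [\sum w = m0 * sigma G], up to a term of the order of the spectral weight. *)
Lemma affordable_narrow G (m0 K : R) m a b :
  covering L A G -> \sum_(Q <- G) (rwidth Q)%:R = m0 * sigma G ->
  0 <= m0 -> K * (1 - m0) = 2 * r%:R -> 0 < a -> 0 < b ->
  affordable L A W m a b
    (2 * Num.max a b * (m0 * sigma G) ^+ m +
     K * Num.sqrt (a * b) * sigma G ^+ m * (1 - m0 ^+ m)).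
Proof.
move=> cG SG m00 KE; elim: m a b => [|m IH] a b a0 b0.
  apply: le_affordable (affordable_base _ _ (ltW a0) (ltW b0)) => //.
  rewrite !expr0 subrr mulr0 mulr1 addr0 mulr2n mulrDl !mul1r.
  by rewrite lerD // le_max lexx ?orbT.
wlog ba : a b a0 b0 / b <= a => [H|].
  case/orP: (le_total a b) => ?; last exact: H.
  by apply: affordable_tr => //; rewrite maxC [a * b]mulrC; apply: H.
rewrite (max_l ba).
have s0 : 0 <= sigma G :> R by apply: sumr_ge0 => Q _; exact: sqrtr_ge0.
set E := Num.sqrt (a * b).
(* The maximum of the new sides is replaced by a sum, which is linear in the widths and so adds up
   to [m0 * sigma G]. *)
pose B (Q : rect r r) := 2 * (a * (rwidth Q)%:R + r%:R * (E * rsigma Q)) *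
  (m0 * sigma G) ^+ m + K * (E * rsigma Q) * sigma G ^+ m * (1 - m0 ^+ m).
apply: (@le_affordable _ _ _ _ _ _ _ _ (\sum_(Q <- G) B Q)) => //; last first.
  apply: affordableS_tr => // Q.
  have h0 := lt_le_trans ltr01 (@rheight_ge1 R _ Q).
  have w0 := lt_le_trans ltr01 (@rwidth_ge1 R _ Q).
  have := IH _ _ (mulr_gt0 a0 w0) (mulr_gt0 b0 h0).
  apply: le_affordable => //; rewrite (sqrtr_rect _ _ _ (ltW a0) (ltW b0)).
  rewrite /B lerD2r.
  rewrite ler_wpM2r ?exprn_ge0 ?mulr_ge0 // ler_pM2l ?ltr0n // ge_max.
  rewrite lerDl !mulr_ge0 ?ler0n ?sqrtr_ge0 //=.
  apply: le_trans (short_side_le _ _ _ (ltW b0) ba) _.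
  by rewrite lerDr mulr_ge0 ?ler0n // ltW.
rewrite /B big_split /= -!mulr_suml -!mulr_sumr big_split /= -!mulr_sumr SG.
rewrite -/(sigma G) !exprMn !exprS le_eqVlt; apply/orP; left; apply/eqP.
(* The choice of [K] makes the error recursion exact: [K * (1 - m0 ^+ m.+1) = 2 * r * m0 ^+ m + K *
   (1 - m0 ^+ m)]. *)
suff : 2 * r%:R * E * sigma G * (m0 ^+ m * sigma G ^+ m) =
       K * (1 - m0) * E * sigma G * (m0 ^+ m * sigma G ^+ m) by lra.
by rewrite KE.
Qed.

(* While the imbalance is small, rectangles of [F] are used, oriented towards
   balance: this multiplies the [p]-th power of the imbalance by [phi] on
   average.  Once it exceeds [m0 ^- m], all remaining steps use [G]. *)
Lemma affordable_balanced F G (m0 K p phi theta q : R) m a b :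
  let D := 2 * (r%:R / m0) + K in
  covering L A F -> covering L A G ->
  \sum_(Q <- G) (rwidth Q)%:R = m0 * sigma G ->
  0 < m0 -> m0 < 1 -> K * (1 - m0) = 2 * r%:R -> 0 <= p ->
  \sum_(Q <- F) rsigma Q * ((rheight Q)%:R / (rwidth Q)%:R) `^ (- (p / 2))
    <= phi * sigma F ->
  phi <= theta -> 0 < theta -> theta < 1 ->
  sigma G = q * sigma F -> 0 <= q -> q <= theta * m0^-1 `^ p ->
  0 < a -> 0 < b -> imbalance a b <= r%:R / m0 * m0^-1 ^+ m ->
  affordable L A W m a b
    (Num.sqrt (a * b) * sigma F ^+ m *
     (D * r%:R `^ p / (1 - theta) * (1 - theta ^+ m) +
      D * theta ^+ m * imbalance a b `^ p)).
Proof.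
move=> D cF cG SG m00 m01 KE p0 phiF phith th0 th1 qE q0 qth.
have K0 : 0 <= K.
  by rewrite -(@pmulr_lge0 _ (1 - m0)) ?subr_gt0 // KE mulr_ge0 ?ler0n.
have D0 : 0 <= D by rewrite addr_ge0 // mulr_ge0 // divr_ge0 ?ler0n // ltW.
have s0 : 0 <= sigma F :> R by apply: sumr_ge0 => Q _; exact: sqrtr_ge0.
(* The sum of the geometric series with terms [D * r ^ p * theta ^ i], which bounds the additive
   errors of all balancing steps. *)
set K' := D * r%:R `^ p / (1 - theta).
have K'0 : 0 <= K'.
  by rewrite divr_ge0 ?mulr_ge0 ?powR_ge0 // subr_ge0 ltW.
have K'E : D * r%:R `^ p = K' - K' * theta.
  by rewrite -{1}[K']mulr1 -mulrBr divfK // gt_eqF // subr_gt0.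
clearbody K'.
have thX n : 0 <= theta ^+ n <= 1.
  by rewrite exprn_ge0 ?exprn_ile1 ?ltW.
(* At the switch to [G], the upper bound on the imbalance controls the long side, and the lower
   bound pays for the factor [q ^+ n]. *)
have narrow n x y : 0 < x -> 0 < y -> m0^-1 ^+ n <= imbalance x y ->
    imbalance x y <= r%:R / m0 * m0^-1 ^+ n ->
    affordable L A W n x y (Num.sqrt (x * y) * sigma F ^+ n *
      (K' * (1 - theta ^+ n) + D * theta ^+ n * imbalance x y `^ p)).
  move=> x0 y0 tge tle.
  have := affordable_narrow G m0 K n x y cG SG (ltW m00) KE x0 y0.
  apply: le_affordable => //.
  have E0 : 0 < Num.sqrt (x * y) by rewrite sqrtr_gt0 mulr_gt0.
  have -> : Num.max x y = imbalance x y * Num.sqrt (x * y).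
    by rewrite divfK // gt_eqF.
  have m0X0 : 0 < m0 ^+ n by rewrite exprn_gt0.
  have {}tle : imbalance x y * m0 ^+ n <= r%:R / m0.
    by rewrite -ler_pdivlMr // -exprVn.
  have m0X1 : m0 ^+ n <= 1 by rewrite exprn_ile1 // ltW.
  have qX : q ^+ n <= theta ^+ n * imbalance x y `^ p.
    apply: (@le_trans _ _ ((theta * m0^-1 `^ p) ^+ n)).
      by rewrite lerXn2r ?nnegrE ?mulr_ge0 ?powR_ge0 ?(ltW th0).
    rewrite exprMn ler_wpM2l ?exprn_ge0 ?(ltW th0) //.
    rewrite -powR_mulrn ?powR_ge0 // powRAC powR_mulrn ?invr_ge0 ?(ltW m00) //.
    rewrite ge0_ler_powR ?nnegrE ?exprn_ge0 ?invr_ge0 ?(ltW m00) //.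
    by rewrite (le_trans ler01) ?imbalance_ge1.
  have sX : 0 <= sigma F ^+ n :> R by rewrite exprn_ge0.
  rewrite qE !exprMn; set E := Num.sqrt _ in E0 *; set t := imbalance x y in tle qX *.
  apply: (@le_trans _ _ (E * sigma F ^+ n * (D * q ^+ n))).
    have -> : 2 * (t * E) * (m0 ^+ n * (q ^+ n * sigma F ^+ n)) +
        K * E * (q ^+ n * sigma F ^+ n) * (1 - m0 ^+ n) =
        E * sigma F ^+ n * ((2 * (t * m0 ^+ n) + K * (1 - m0 ^+ n)) * q ^+ n).
      by ring.
    rewrite ler_wpM2l ?mulr_ge0 ?(ltW E0) // ler_wpM2r ?exprn_ge0 // lerD //.
      by rewrite ler_wpM2l.
    by rewrite ler_piMr // lerBlDr lerDl ltW.
  rewrite ler_wpM2l ?mulr_ge0 ?(ltW E0) //.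
  have /andP[_ th1'] := thX n.
  rewrite -[leLHS]add0r lerD ?mulr_ge0 ?subr_ge0 //.
  by rewrite -mulrA ler_wpM2l.
elim: m a b => [|m IH] a b a0 b0 tle.
  (* At [m = 0] the threshold is 1, which every imbalance reaches. *)
  by apply: narrow; rewrite ?expr0 ?imbalance_ge1.
have [|tlt] := leP (m0^-1 ^+ m.+1) (imbalance a b); first by move=> ?; apply: narrow.
wlog ba : a b a0 b0 tle tlt / b <= a => [H|].
  case/orP: (le_total a b) => ?; last exact: H.
  apply: affordable_tr => //; rewrite [a * b]mulrC imbalanceC.
  by apply: H => //; rewrite imbalanceC.
set E := Num.sqrt (a * b); set t := imbalance a b.
have E0 : 0 <= E := sqrtr_ge0 _.
pose B (Q : rect r r) := E * sigma F ^+ m *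
  (rsigma Q * (K' * (1 - theta ^+ m) + D * theta ^+ m * r%:R `^ p) +
   D * theta ^+ m * t `^ p *
     (rsigma Q * ((rheight Q)%:R / (rwidth Q)%:R) `^ (- (p / 2)))).
apply: (@le_affordable _ _ _ _ _ _ _ _ (\sum_(Q <- F) B Q)) => //; last first.
  apply: affordableS_tr => // Q.
  have h0 := lt_le_trans ltr01 (@rheight_ge1 R _ Q).
  have w0 := lt_le_trans ltr01 (@rwidth_ge1 R _ Q).
  have s1 : 0 <= rsigma Q :> R by rewrite sqrtr_ge0.
    (* From below [m0^-1 ^+ m.+1], a step of factor at most [r] lands in the range allowed with [m]
       steps left. *)
    have tle' : imbalance (a * (rwidth Q)%:R) (b * (rheight Q)%:R) <=
      r%:R / m0 * m0^-1 ^+ m.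
    apply: le_trans (imbalance_rect_le _ _ _ b0 ba) _.
    by rewrite -mulrA -exprS ler_wpM2l ?ler0n // ltW.
  have := IH _ _ (mulr_gt0 a0 w0) (mulr_gt0 b0 h0) tle'.
  apply: le_affordable => //; rewrite (sqrtr_rect _ _ _ (ltW a0) (ltW b0)).
  have -> : B Q = E * rsigma Q * sigma F ^+ m * (K' * (1 - theta ^+ m) +
     D * theta ^+ m * (t `^ p * ((rheight Q)%:R / (rwidth Q)%:R) `^ (- (p / 2))
       + r%:R `^ p)) by rewrite /B; ring.
  have /andP[thX0 _] := thX m.
  rewrite ler_wpM2l ?mulr_ge0 ?exprn_ge0 // lerD2l ler_wpM2l ?mulr_ge0 //.
  exact: imbalance_rect_powR.
rewrite /B -mulr_sumr big_split /= -mulr_suml -mulr_sumr -/(sigma F).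
have /andP[thX0 thX1] := thX m.
rewrite [sigma F ^+ m.+1]exprSr mulrA -[leRHS]mulrA ler_wpM2l ?mulr_ge0 ?exprn_ge0 //.
rewrite [leRHS]mulrDr lerD //.
  by rewrite ler_wpM2l // [D * _ * _]mulrAC K'E exprS; lra.
have -> : sigma F * (D * theta ^+ m.+1 * t `^ p) =
    D * theta ^+ m * t `^ p * (theta * sigma F) by rewrite exprS; ring.
rewrite ler_wpM2l ?mulr_ge0 ?powR_ge0 //.
by apply: le_trans phiF _; rewrite ler_wpM2r.
Qed.

End Phases.

(** * Choice of the exponent and the constants *)

Lemma chi_neg_sizes (R : realType) r (F : seq (rect r r)) (x : R) :
  chi F x < 0 -> 0 < sigma F :> R /\ (1 < r)%N.
Proof.
rewrite /chi subr_lt0 => chiF; split.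
  apply: le_lt_trans chiF; apply: sumr_ge0 => Q _.
  by rewrite mulr_ge0 ?sqrtr_ge0 ?powR_ge0.
(* For [r <= 1] every rectangle is [1 x 1], so all ratios are 1 and [chi F] vanishes. *)
rewrite ltnNge; apply/negP => r1; move: chiF; rewrite ltNge => /negP; apply.
have size1 (X : {set 'I_r}) : X != set0 -> #|X| = 1%N.
  rewrite -card_gt0 => X0; apply/eqP; rewrite eqn_leq X0 andbT.
  by rewrite (leq_trans (max_card _)) ?card_ord.
rewrite le_eqVlt; apply/orP; left; apply/eqP; apply: eq_bigr => Q _.
rewrite /rheight /rwidth !size1 ?rrows_neq0 ?rcols_neq0 //.
by rewrite divff ?oner_neq0 // powR1 mulr1.
Qed.

Lemma mu_one_sided (R : realType) r (G : seq (rect r r)) : one_sided G ->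
  mu G = (sigma G)^-1 * \sum_(Q <- G) (rwidth Q)%:R :> R.
Proof.
(* Rewriting [G] as a filtered sequence makes one-sidedness available inside the sum. *)
move=> /all_filterP <-; rewrite /mu; congr (_ * _); rewrite !big_filter.
apply: eq_bigr => Q wQ.
have h0 := lt_le_trans ltr01 (@rheight_ge1 R _ Q).
have w0 := lt_le_trans ltr01 (@rwidth_ge1 R _ Q).
rewrite /narrowness (maxn_idPl wQ) (minn_idPr wQ) /rsigma.
rewrite -sqrtrV ?divr_ge0 ?ler0n // -sqrtrM ?mulr_ge0 ?ler0n //.
rewrite -[RHS]ger0_norm ?ler0n // -sqrtr_sqr; congr Num.sqrt.
by field; rewrite !gt_eqF.
Qed.

Lemma rwidth_le_rsigma (R : realType) r (Q : rect r r) :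
  (rwidth Q <= rheight Q)%N -> (rwidth Q)%:R <= rsigma Q :> R.
Proof.
move=> wh; rewrite -[leLHS]ger0_norm ?ler0n // -sqrtr_sqr ler_wsqrtr //.
by rewrite expr2 ler_wpM2r ?ler0n // ler_nat.
Qed.

Lemma powR_shift_lt (R : realType) (q m0 l eps : R) : 0 < m0 -> m0 < 1 ->
  0 < eps -> 0 < q -> q < m0 `^ (2 * l) ->
  exists2 l', l < l' < l + eps & q < m0 `^ (2 * l').
Proof.
move=> m00 m01 eps0 q0.
have E y : (q < m0 `^ y) = (ln q < y * ln m0).
  by rewrite -ln_powR ltr_ln ?posrE ?powR_gt0.
have : ln m0 < 0 by rewrite ln_lt0 // m00.
rewrite E; set u := ln m0; set v := ln q => u0 vu.
(* Since [u < 0], the condition on [d] is [d < (v - 2 * l * u) / (2 * u)]; half of that bound keeps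
   it strict. *)
pose d := Num.min (eps / 2) ((v - 2 * l * u) / (4 * u)).
have d0 : 0 < d.
  rewrite lt_min divr_gt0 //= -mulrNN -invrN divr_gt0 //; lra.
exists (l + d).
  have : d <= eps / 2 by rewrite ge_min lexx.
  by move=> de; apply/andP; split; lra.
rewrite E -/u -/v.
have : d <= (v - 2 * l * u) / (4 * u) by rewrite ge_min lexx orbT.
rewrite ler_ndivlMr; nra.
Qed.

Lemma powR_logb (R : realType) (r n : nat) (x : R) : (1 < r)%N -> 0 < x ->
  ((r ^ n)%N%:R) `^ (logb r%:R x) = x ^+ n.
Proof.
move=> r1 x0; have lnr : 0 < ln (r%:R : R) by rewrite ln_gt0 // ltr1n.
rewrite natrX -powR_mulrn ?ler0n // powRAC /logb.
suff -> : r%:R `^ (ln x / ln r%:R) = x by rewrite powR_mulrn // ltW.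
rewrite /powR gt_eqF ?ltr0n ?(ltnW r1) // divfK ?gt_eqF // lnK //.
Qed.

Theorem theorem1 (R : realType) (L : mode) (r : nat) (A : 'M[bool]_r)
    (F G : seq (rect r r)) (lambda : R) :
  A^T = A ->
  covering L A F -> compact_covering (R := R) F -> is_lambda F lambda ->
  covering L A G -> compact_covering (R := R) G -> one_sided G ->
  sigma F <= sigma G :> R ->
  sigma G / sigma F < mu G `^ (2 * lambda) ->
  exists C : R, 0 < C /\
    forall n : nat, (1 <= n)%N ->
      (L2 L (kron_pow A n))%:R <=
        C * ((r ^ n)%N%:R) `^ (logb r%:R (sigma F)).
Proof.
move=> symA cF [x [_ chiF]] [[_ [eps [eps0 chieps]]] _] cG _ oneG sFG qmu.
have [sF0 r1] := chi_neg_sizes _ _ _ _ chiF.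
have sG0 : 0 < sigma G :> R := lt_le_trans sF0 sFG.
have q1 : 1 <= sigma G / sigma F :> R by rewrite ler_pdivlMr ?mul1r.
have muE := mu_one_sided R _ _ oneG.
have SG : \sum_(Q <- G) (rwidth Q)%:R = mu G * sigma G :> R.
  by rewrite muE mulrAC mulVf ?mul1r // gt_eqF.
have mu1 : mu G <= 1 :> R.
  rewrite muE mulrC ler_pdivrMr // mul1r -(all_filterP oneG) /sigma !big_filter.
  by apply: ler_sum => Q; exact: rwidth_le_rsigma.
have mu_neq1 : mu G != 1 :> R.
  by apply/eqP => E; move: qmu; rewrite E powR1 ltNge q1.
have mu_lt1 : mu G < 1 :> R by rewrite lt_neqAle mu_neq1.
have mu0 : 0 < mu G :> R.
  rewrite lt_neqAle eq_sym; apply/andP; split; last first.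
    by rewrite muE mulr_ge0 ?invr_ge0 ?(ltW sG0) ?sumr_ge0.
  (* A power of 0 is 1 for exponent 0 and 0 otherwise, hence never exceeds [q]. *)
  apply/eqP => E; move: qmu; rewrite E ltNge => /negP; apply.
  apply: le_trans q1; have [->|l0] := eqVneq (2 * lambda) 0; first by rewrite powRr0.
  by rewrite powR0.
set q := sigma G / sigma F in q1 qmu.
have q0 : 0 < q := lt_le_trans ltr01 q1.
(* Just to the right of [lambda], [chi F] is negative and the strict hypothesis on [q] survives. *)
have [l ll ql] := powR_shift_lt _ _ _ _ _ mu0 mu_lt1 eps0 q0 qmu.
have l0 : l < 0.
  rewrite ltNge; apply/negP => l0; move: ql; apply/negP; rewrite -leNgt.
  apply: le_trans q1; rewrite -[leRHS](powRr0 (mu G)) ger_powR ?mu0 //.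
  by rewrite mulr_ge0.
(* With this [p], [chi F l < 0] says [phi < 1], and [ql] says [delta < 1]. *)
pose p := - (2 * l); have p0 : 0 <= p by rewrite /p; lra.
pose S := \sum_(Q <- F) rsigma Q * ((rheight Q)%:R / (rwidth Q)%:R) `^ l : R.
pose phi := S / sigma F; pose delta := q * mu G `^ p.
pose theta := Num.max phi delta.
have phi1 : phi < 1.
  by rewrite ltr_pdivrMr // mul1r -subr_lt0; exact: chieps.
have delta1 : delta < 1.
  by rewrite /delta /p powRN ltr_pdivrMr ?powR_gt0 // mul1r.
have th0 : 0 < theta by rewrite lt_max orbC /delta mulr_gt0 ?powR_gt0.
have th1 : theta < 1 by rewrite gt_max phi1.
pose W : R := (complexity F)%:R; pose K : R := 2 * r%:R / (1 - mu G).
pose D : R := 2 * (r%:R / mu G) + K.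
pose K' : R := D * r%:R `^ p / (1 - theta).
have D0 : 0 <= D.
  by rewrite addr_ge0 ?mulr_ge0 ?invr_ge0 ?ler0n ?(ltW mu0) // subr_ge0.
have K'0 : 0 <= K'.
  by rewrite !mulr_ge0 ?powR_ge0 // invr_ge0 subr_ge0 ltW.
have WKD0 : 0 <= W * (K' + D) := mulr_ge0 (ler0n _ _) (addr_ge0 K'0 D0).
(* The base factor is paid by [W] rather than by [sigma F], hence the division; the added 1 makes
   the constant positive. *)
exists (W * (K' + D) / sigma F + 1); split.
  by rewrite ltr_wpDl // divr_ge0 // ltW.
case=> // n _; rewrite powR_logb //.
have KE : K * (1 - mu G) = 2 * r%:R by rewrite divfK // gt_eqF // subr_gt0.
have phiF : \sum_(Q <- F)
    rsigma Q * ((rheight Q)%:R / (rwidth Q)%:R) `^ (- (p / 2)) <= phi * sigma F.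
  have -> : - (p / 2) = l by rewrite /p; field.
  by rewrite divfK // gt_eqF.
have phith : phi <= theta by rewrite le_max lexx.
have qE : sigma G = q * sigma F by rewrite divfK // gt_eqF.
have qth : q <= theta * (mu G)^-1 `^ p.
  rewrite -powR_inv1 ?(ltW mu0) // -powRrM mulN1r powRN.
  by rewrite ler_pdivlMr ?powR_gt0 // le_max lexx orbT.
have imb1 : imbalance (1 : R) 1 = 1.
  by rewrite /imbalance maxxx mulr1 sqrtr1 divr1.
have imbr : imbalance (1 : R) 1 <= r%:R / mu G * (mu G)^-1 ^+ n.
  rewrite imb1 -mulrA -exprS mulr_ege1 //; first by rewrite ler1n ltnW.
  by rewrite exprn_ege1 // invf_ge1.
(* The construction starts from a [1 x 1] rectangle, for which the weighted cost is the
   complexity. *)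
have [H cH wH] := affordable_balanced symA (ler0n _ _)
  (fun a b => affordable0 F a b cF) F G (mu G) K p phi theta q n 1 1
  cF cG SG mu0 mu_lt1 KE p0 phiF phith th0 th1 qE (ltW q0) qth ltr01 ltr01 imbr.
have complexityE : (complexity H)%:R = wcost 1 1 H :> R.
  rewrite /complexity /wcost natr_sum; apply: eq_bigr => Q _.
  by rewrite !mul1r -natrD.
apply: (@le_trans _ _ (wcost 1 1 H)).
  by rewrite -complexityE ler_nat L2_le.
apply: le_trans wH _; rewrite mulr1 sqrtr1 mul1r imb1 powR1 mulr1.
rewrite -/W -/D -/K' [leRHS]mulrDl mul1r ler_wpDr ?exprn_ge0 ?(ltW sF0) //.
rewrite [leRHS](_ : _ = W * (sigma F ^+ n * (K' + D))); last first.
  by rewrite exprS; field; rewrite gt_eqF.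
have /andP[thX0 thX1] : 0 <= theta ^+ n <= 1.
  by rewrite exprn_ge0 ?exprn_ile1 ?ltW.
rewrite ler_wpM2l ?ler0n // ler_wpM2l ?exprn_ge0 ?(ltW sF0) // lerD //.
  by rewrite ler_piMr // lerBlDr lerDl.
by rewrite ler_piMr.
Qed.
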